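(* Let $1<\alpha<2$, and let $\mathcal B=\{\varphi_1,\dots,\varphi_N\}$ be a finite element basis on $[L,R]$. Let $\mathcal M^{+}\in\mathbb C^{N\times N}$ be the matrix with entries $$(\mathcal M^{+})_{ij}=\frac{1}{\Gamma(2-\alpha)}\int_L^R\varphi_i(x)\,\frac{\partial^2}{\partial x^2}\int_L^x\varphi_j(y)(x-y)^{-\alpha+1}\,dy\,dx$$ (the case of diffusion coefficient $d_+(x)\equiv1$). Assume that $\mathcal B$ has $\delta$-overlapping $k$ with $\delta>0$, and that the basis functions $\varphi_i(x)\ge0$ are normalized to have $\int_L^R\varphi_i(x)\,dx=1$. Then, for $\epsilon>0$, $$\mathrm{qsrank}_\epsilon(\mathcal M^{+})\le k+k_\epsilon=k+2\left\lceil\log_2\left(\frac{R-L}{\delta}\right)\right\rceil\cdot\left(1+\left\lceil\log_2\left(\frac{(\alpha+1)\cdot4^{\alpha+1}}{\epsilon}\right)\right\rceil\right),$$ where $k_\epsilon$ denotes the second summand on the right.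
   Context: The basis functions have compact support and vanish on the boundary of $[L,R]$; $\mathcal M^+$ is the stiffness matrix $\langle\varphi_i,\partial^\alpha\varphi_j/\partial_+^{RL}x^\alpha\rangle$ of the left-handed Riemann–Liouville derivative of order $\alpha$ with diffusion coefficient $d_+\equiv1$, and $\Gamma$ is the gamma function. The basis $\mathcal B$ has $\delta$-overlapping $k$ ($\delta\ge0$) if for all $j_1,j_2\in\{1,\dots,N\}$ with $j_2-j_1\ge k$ there exists $x_0\in[L,R]$ such that $\mathrm{supp}(\varphi_j)\subset[L,x_0-\delta]$ for all $j<j_1$ and $\mathrm{supp}(\varphi_j)\subset[x_0+\delta,R]$ for all $j>j_2$. $\|\cdot\|$ is the Euclidean (spectral) norm. For a square matrix $X$, $\mathrm{Off}(X)$ denotes the set of off-diagonal blocks of $X$, i.e. the submatrices entirely contained in the strictly lower or in the strictly upper triangular part of $X$, and $$\mathrm{qsrank}_\epsilon(X)=\max_{Y\in\mathrm{Off}(X)}\ \min_{\|\delta Y\|\le\epsilon\|X\|}\mathrm{rank}(Y+\delta Y)$$ (with value $0$ if $X$ has no off-diagonal blocks).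
   Formalization: The second summand k_ε is replaced by max(0, k_ε), because the stated bound can be negative and hence false when ε is very large, or when δ exceeds R−L and the overlap condition is vacuous. *)

(* Defs.v *)
From mathcomp Require Import all_boot all_order all_algebra.
From mathcomp Require Import complex.
From mathcomp Require Import all_classical all_reals all_analysis.

Set Implicit Arguments.
Unset Strict Implicit.
Unset Printing Implicit Defensive.

Import Order.TTheory GRing.Theory Num.Theory.
Import numFieldNormedType.Exports.

Local Open Scope classical_set_scope.
Local Open Scope ring_scope.

Section SpectralNorm.
Variable R : realType.

Definition euclid_norm n (v : 'cV[R[i]]_n) : R :=
  Num.sqrt (\sum_(i < n) ComplexField.Normc.normc (v i ord0) ^+ 2).

Definition spectral_norm p q (A : 'M[R[i]]_(p, q)) : R :=
  sup [set euclid_norm (A *m v) | v in [set v | euclid_norm v <= 1]].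

End SpectralNorm.

Section QuasiseparableRank.
Variable R : realType.

(* The least value of \rank (Y + D)%R over all D with spectral_norm D <= t.
   Without %R the sum would be the sum of row spaces.  The default minn p q bounds every rank, so it never affects the minimum when
   0 <= t (see min_perturbed_rankP). *)
Definition min_perturbed_rank p q (Y : 'M[R[i]]_(p, q)) (t : R) : nat :=
  \big[minn/minn p q]_(r < (minn p q).+1 |
    `[< exists2 D : 'M[R[i]]_(p, q), spectral_norm D <= t & \rank (Y + D)%R = r >])
    r.

Lemma euclid_norm0 n : euclid_norm (0 : 'cV[R[i]]_n) = 0.
Proof.
rewrite /euclid_norm big1 ?sqrtr0// => i _.
by rewrite mxE /= expr0n /= addr0 sqrtr0 expr0n.
Qed.

Lemma spectral_norm0 p q : spectral_norm (0 : 'M[R[i]]_(p, q)) = 0.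
Proof.
rewrite /spectral_norm -[RHS](@sup1 R 0); congr sup.
apply/seteqP; split=> x /=.
  by move=> [v _ <-]; rewrite mul0mx euclid_norm0.
move=> ->; exists 0; last by rewrite mul0mx euclid_norm0.
by rewrite /= euclid_norm0 ler01.
Qed.

Lemma min_perturbed_rankP p q (Y : 'M[R[i]]_(p, q)) (t : R) : 0 <= t ->
  (exists2 D : 'M[R[i]]_(p, q), spectral_norm D <= t &
     \rank (Y + D)%R = min_perturbed_rank Y t) /\
  (forall D : 'M[R[i]]_(p, q), spectral_norm D <= t ->
     (min_perturbed_rank Y t <= \rank (Y + D)%R)%N).
Proof.
move=> t0.
have rk (D : 'M[R[i]]_(p, q)) : (\rank (Y + D)%R <= minn p q)%N.
  by rewrite leq_min; apply/andP; split; [exact: rank_leq_row|exact: rank_leq_col].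
have lb (D : 'M[R[i]]_(p, q)) : spectral_norm D <= t ->
    (min_perturbed_rank Y t <= \rank (Y + D)%R)%N.
  move=> Dt; have rD : (\rank (Y + D)%R < (minn p q).+1)%N by rewrite ltnS.
  rewrite /min_perturbed_rank; move: (mem_index_enum (Ordinal rD)).
  elim: (index_enum _) => //= r s IHs; rewrite inE big_cons.
  case/orP => [/eqP<-|/IHs {}IHs]; last first.
    by case: ifP => // _; exact: leq_trans (geq_minr _ _) IHs.
  rewrite ifT; first exact: geq_minl.
  by apply/asboolP; exists D.
split=> //.
have Q0 : exists2 D : 'M[R[i]]_(p, q), spectral_norm D <= t &
    (\rank (Y + D)%R <= minn p q)%N.
  by exists 0; rewrite ?spectral_norm0.
suff [D Dt Dr] : exists2 D : 'M[R[i]]_(p, q), spectral_norm D <= t &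
    (\rank (Y + D)%R <= min_perturbed_rank Y t)%N.
  by exists D => //; apply/eqP; rewrite eqn_leq Dr lb.
rewrite /min_perturbed_rank; apply: (big_ind (fun m => exists2 D,
    spectral_norm D <= t & (\rank (Y + D)%R <= m)%N)) => //.
- by move=> m n hm hn; rewrite /minn; case: ifP.
- by move=> r /asboolP[D Dt <-]; exists D.
Qed.

Definition submatrix n (X : 'M[R[i]]_n) (I J : {set 'I_n}) :
    'M[R[i]]_(#|I|, #|J|) :=
  mxsub (@enum_val _ (mem I)) (@enum_val _ (mem J)) X.

Definition strictly_lower n (I J : {set 'I_n}) : bool :=
  [forall i in I, forall j in J, (j < i)%N].

Definition strictly_upper n (I J : {set 'I_n}) : bool :=
  [forall i in I, forall j in J, (i < j)%N].

(* Blocks with no rows or no columns are allowed: they have rank 0, which is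
   also the value of the maximum over an empty range. *)
Definition qsrank n (e : R) (X : 'M[R[i]]_n) : nat :=
  \max_(B : {set 'I_n} * {set 'I_n} |
      strictly_lower B.1 B.2 || strictly_upper B.1 B.2)
    min_perturbed_rank (submatrix X B.1 B.2) (e * spectral_norm X).

End QuasiseparableRank.

Section FiniteElements.
Variable R : realType.

Definition supp (f : R -> R) : set R := closure [set x | f x != 0].

(* Functions on [xL, xR] are represented by their extension by 0 to R. *)
Record fe_basis (xL xR : R) N (phi : 'I_N -> R -> R) : Prop := FEBasis {
  fe_supp : forall i, supp (phi i) `<=` `[xL, xR];
  fe_left : forall i, phi i xL = 0;
  fe_right : forall i, phi i xR = 0;
  fe_integrable : forall i,
    (@lebesgue_measure R).-integrable `[xL, xR] (EFin \o phi i);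
  fe_free : forall c : 'I_N -> R,
    (forall x, \sum_(i < N) c i * phi i x = 0) -> forall i, c i = 0 }.

Definition overlapping (xL xR : R) N (phi : 'I_N -> R -> R) (delta : R)
    (k : nat) : Prop :=
  forall j1 j2 : 'I_N, (j1 + k <= j2)%N ->
    exists x0 : R, [/\ x0 \in `[xL, xR],
      forall j : 'I_N, (j < j1)%N -> supp (phi j) `<=` `[xL, x0 - delta] &
      forall j : 'I_N, (j2 < j)%N -> supp (phi j) `<=` `[x0 + delta, xR]].

Definition Gamma (s : R) : R :=
  (\int[@lebesgue_measure R]_(t in `]0%R, +oo[) (t `^ (s - 1) * expR (- t)))%R.

(* The factor 1 / Gamma (2 - alpha) of the Riemann-Liouville derivative is
   kept outside, in stiffness. *)
Definition RL_integral (alpha xL : R) (f : R -> R) (x : R) : R :=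
  (\int[@lebesgue_measure R]_(y in `[xL, x])
     (f y * (x - y) `^ (- alpha + 1)))%R.

Definition stiffness (alpha xL xR : R) N (phi : 'I_N -> R -> R) :
    'M[R[i]]_N :=
  \matrix_(i < N, j < N)
    ((Gamma (2 - alpha))^-1 *
     (\int[@lebesgue_measure R]_(x in `[xL, xR])
        (phi i x * derive1n 2 (RL_integral alpha xL (phi j)) x))%R)%:C%C.

Definition log2 (x : R) : R := ln x / ln 2.

(* k_eps bounds a rank, hence the truncation at 0.  The formula is nonnegative
   unless delta > xR - xL (possible when the overlap condition is vacuous) or
   eps > (alpha + 1) * 4 `^ (alpha + 1); in those regimes even k + k_eps could
   be negative without it. *)
Definition k_eps (alpha xL xR delta eps : R) : int :=
  Num.max 0
    (2 * Num.ceil (log2 ((xR - xL) / delta)) *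
     (1 + Num.ceil (log2 ((alpha + 1) * 4 `^ (alpha + 1) / eps)))).

End FiniteElements.

(* Main.v *)
(** Take a strictly lower block and let i1 be its first row.  The overlap
    condition splits it into at most k + 1 rows and the rows beyond i1 + k, for
    which the test functions live at distance at least 2 delta from all the
    trial functions of the block.  There one may differentiate under the
    integral sign, and the entry is, up to a nonnegative factor, the double
    integral of phi_i(x) phi_j(y) (x - y)^(-alpha-1).  Splitting y dyadically
    according to its distance to the point x0 between the supports, a Taylor
    expansion of the kernel around the centre of each dyadic interval converges
    geometrically with a relative error, so it yields a separable approximation
    whose error is at most eps times the entry.  As all these entries are
    nonnegative, an entrywise relative error is a relative error in spectral
    norm.  In a strictly upper block the entries beyond the first k + 1 columns
    vanish.  Only half of k_eps is needed, which absorbs the extra 1. *)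

Require Import Defs.
From mathcomp Require Import all_boot all_order all_algebra.
From mathcomp Require Import complex ring lra.
From mathcomp Require Import all_classical all_reals all_analysis.
From mathcomp Require Import measurable_realfun.

Set Implicit Arguments.
Unset Strict Implicit.
Unset Printing Implicit Defensive.

Import Order.TTheory GRing.Theory Num.Theory.
Import numFieldNormedType.Exports.

Local Open Scope classical_set_scope.
Local Open Scope ring_scope.

Import ComplexField.Normc.

(** * Euclidean and spectral norms of complex matrices *)

Lemma normcE (R : realType) (x : R) : normc x%:C%C = `|x|.
Proof. by rewrite /= expr0n addr0 sqrtr_sqr. Qed.

Lemma normc_sum (R : realType) (I : finType) (f : I -> R[i]) :
  normc (\sum_i f i) <= \sum_i normc (f i).
Proof.
apply: (big_ind2 (fun x y => normc x <= y)) => //.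
  by rewrite normc0.
move=> x1 x2 y1 y2 h1 h2; apply: (le_trans (le_normcD _ _)).
exact: lerD.
Qed.

Lemma normc_ge0 (R : realType) (x : R[i]) : 0 <= normc x.
Proof. by case: x => a b /=; exact: sqrtr_ge0. Qed.

Lemma euclid_norm_le (R : realType) n (e : R) (u v : 'cV[R[i]]_n) : 0 <= e ->
  (forall i, normc (u i ord0) <= e * normc (v i ord0)) ->
  euclid_norm u <= e * euclid_norm v.
Proof.
move=> e0 uv; rewrite /euclid_norm.
have {1}-> : e = Num.sqrt (e ^+ 2) by rewrite sqrtr_sqr ger0_norm.
rewrite -sqrtrM ?sqr_ge0//; apply: ler_wsqrtr.
rewrite mulr_sumr; apply: ler_sum => i _; rewrite -exprMn.
by rewrite lerXn2r ?nnegrE ?mulr_ge0 ?normc_ge0.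
Qed.

Lemma spectral_norm_ubP (R : realType) p q (A : 'M[R[i]]_(p, q)) (v : 'cV_q) :
  euclid_norm v <= 1 -> euclid_norm (A *m v) <= spectral_norm A.
Proof.
move=> v1; apply: ub_le_sup; last by exists v.
(* A supremum bounds its set only if that set is bounded above. Entries of a vector in the unit ball
   have modulus at most 1, so the vector of row sums of moduli of [A] dominates [A *m w]
   entrywise. *)
exists (1 * euclid_norm (\col_(i < p) (\sum_j normc (A i j))%:C%C)).
move=> _ [w /= w1 <-]; apply: euclid_norm_le => // i.
rewrite mul1r !mxE normcE ger0_norm; last first.
  by apply: sumr_ge0 => j _; exact: normc_ge0.
apply: (le_trans (normc_sum _)); apply: ler_sum => j _.
rewrite normcM ler_piMr ?normc_ge0//; apply: le_trans w1.
rewrite -[leLHS]ger0_norm ?normc_ge0// -sqrtr_sqr; apply: ler_wsqrtr.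
rewrite (bigD1 j)//= lerDl; apply: sumr_ge0 => k _; exact: sqr_ge0.
Qed.

Lemma spectral_norm_le (R : realType) p q (A : 'M[R[i]]_(p, q)) (t : R) :
  (forall v, euclid_norm v <= 1 -> euclid_norm (A *m v) <= t) ->
  spectral_norm A <= t.
Proof.
move=> At; apply: ge_sup; last by move=> _ [v /= v1 <-]; exact: At.
by exists (euclid_norm (A *m 0)), 0 => //=; rewrite euclid_norm0.
Qed.

Lemma spectral_norm_ge0 (R : realType) p q (A : 'M[R[i]]_(p, q)) :
  0 <= spectral_norm A.
Proof.
have := @spectral_norm_ubP _ _ _ A 0; rewrite euclid_norm0 mulmx0 euclid_norm0.
exact.
Qed.

Lemma sum_injective (V : nmodType) (aT rT : finType) (g : aT -> rT)
    (F : rT -> V) : injective g -> (forall j, j \notin codom g -> F j = 0) ->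
  \sum_j F j = \sum_l F (g l).
Proof.
move=> gI F0; rewrite [RHS](partition_big g predT)//=; apply: eq_bigr => j _.
have [/codomP[l ->]|jg] := boolP (j \in codom g).
  by rewrite (big_pred1 l)// => s; rewrite /= (inj_eq gI).
by rewrite F0// big1// => l /eqP gl; rewrite gl F0.
Qed.

(** Extending [v] by zero along [g] gives [w] of the same norm, and the submatrix applied to [v]
    only collects some of the coordinates of [X *m w]. *)
Lemma spectral_norm_mxsub (R : realType) p q m n (f : 'I_p -> 'I_m)
    (g : 'I_q -> 'I_n) (X : 'M[R[i]]_(m, n)) :
  injective f -> injective g ->
  spectral_norm (mxsub f g X) <= spectral_norm X.
Proof.
move=> fI gI; apply: spectral_norm_le => v v1.
pose w : 'cV[R[i]]_n := \col_j \sum_(l | g l == j) v l ord0.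
have wg l : w (g l) ord0 = v l ord0.
  by rewrite mxE (big_pred1 l)// => s; rewrite /= (inj_eq gI).
have w0 j : j \notin codom g -> w j ord0 = 0.
  move=> jg; rewrite mxE big1// => l /eqP gl.
  by rewrite -gl codom_f in jg.
have <- : mxsub f id (X *m w) = mxsub f g X *m v.
  apply/matrixP => i r; rewrite 2![LHS]mxE [RHS]mxE (ord1 r) (@sum_injective _ _ _ g)//.
    by apply: eq_bigr => l _; rewrite [in RHS]mxE wg.
  by move=> j jg; rewrite w0 ?mulr0.
apply: (@le_trans _ _ (euclid_norm (X *m w))).
  apply: ler_wsqrtr.
  pose F j := if j \in codom f
    then normc ((X *m w) j ord0) ^+ 2 else 0.
  apply: (@le_trans _ _ (\sum_j F j)).
    rewrite (@sum_injective _ _ _ f)//; last by move=> j; rewrite /F => /negPf->.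
    by apply: ler_sum => i _; rewrite /F codom_f !mxE.
  by apply: ler_sum => j _; rewrite /F; case: ifP => // _; exact: sqr_ge0.
apply: spectral_norm_ubP; apply: le_trans v1; apply: ler_wsqrtr.
rewrite (@sum_injective _ _ _ g)//.
  by apply: ler_sum => l _; rewrite wg.
by move=> j jg; rewrite w0 ?normc0 ?expr0n.
Qed.

(** Replacing the entries of [v] by their moduli keeps the norm and turns the triangle inequality in
    row [i] of [d *m v] into a comparison with the same row of [y *m w]. On rows outside [P] the
    left side is 0, so [y] may have any sign there. *)
Lemma spectral_norm_dominated (R : realType) p q (P : pred 'I_p) (e : R)
    (d y : 'M[R]_(p, q)) : 0 <= e ->
  (forall i j, P i -> `|d i j| <= e * y i j) ->
  (forall i j, ~~ P i -> d i j = 0) ->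
  spectral_norm (map_mx (real_complex R) d)
    <= e * spectral_norm (map_mx (real_complex R) y).
Proof.
move=> e0 dy d0; apply: spectral_norm_le => v v1.
pose w : 'cV[R[i]]_q := \col_j (normc (v j ord0))%:C%C.
have w1 : euclid_norm w <= 1.
  apply: le_trans v1; apply: ler_wsqrtr; apply: ler_sum => j _.
  by rewrite mxE normcE ger0_norm ?normc_ge0.
apply: (@le_trans _ _ (e * euclid_norm (map_mx (real_complex R) y *m w)));
  last by rewrite ler_wpM2l// spectral_norm_ubP.
apply: euclid_norm_le => // i; rewrite !mxE.
have [Pi|nPi] := boolP (P i); last first.
  rewrite big1 ?normc0 ?mulr_ge0 ?normc_ge0// => j _.
  by rewrite !mxE d0// rmorph0 mul0r.
have -> : \sum_j map_mx (real_complex R) y i j * w j ord0 =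
    (\sum_j y i j * normc (v j ord0))%:C%C.
  by rewrite rmorph_sum; apply: eq_bigr => j _; rewrite !mxE rmorphM.
rewrite normcE; apply: (le_trans (normc_sum _)).
apply: (@le_trans _ _ (e * \sum_j y i j * normc (v j ord0))); last first.
  by rewrite ler_wpM2l// ler_norm.
rewrite mulr_sumr; apply: ler_sum => j _.
by rewrite mxE normcM normcE mulrA ler_wpM2r ?normc_ge0 ?dy.
Qed.

Lemma spectral_normN (R : realType) p q (A : 'M[R[i]]_(p, q)) :
  spectral_norm (- A) = spectral_norm A.
Proof.
have le B : spectral_norm (- B : 'M[R[i]]_(p, q)) <= spectral_norm B.
  apply: spectral_norm_le => v v1.
  apply: le_trans (spectral_norm_ubP B v1).
  rewrite -[leRHS]mul1r; apply: euclid_norm_le => // i.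
  by rewrite mulNmx mxE normcN mul1r.
by apply/eqP; rewrite eq_le le/= -{1}[A]opprK le.
Qed.

(** * Upper bounds for ranks and perturbed ranks *)

Lemma min_perturbed_rank_le (R : realType) p q (Y D : 'M[R[i]]_(p, q)) (t : R)
    (r : nat) :
  spectral_norm D <= t -> (\rank (Y + D)%R <= r)%N ->
  (min_perturbed_rank Y t <= r)%N.
Proof.
move=> Dt; apply: leq_trans; apply: (min_perturbed_rankP Y _).2 => //.
exact: le_trans (spectral_norm_ge0 D) Dt.
Qed.

Lemma mxrank_row_support (F : fieldType) p q (A : 'M[F]_(p, q))
    (P : {set 'I_p}) :
  (forall i j, i \notin P -> A i j = 0) -> (\rank A <= #|P|)%N.
Proof.
move=> A0.
(* A 0/1 matrix puts the rows in [P] back in place, so [A] factors through a space of dimension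
   [#|P|]. *)
suff -> : A = (\matrix_(i, s) (i == @enum_val _ (mem P) s)%:R) *m
    rowsub (@enum_val _ (mem P)) A.
  exact: leq_trans (mulmx_max_rank _ _) (leqnn _).
apply/matrixP => i j; rewrite mxE.
under eq_bigr do rewrite !mxE.
have [iP|iP] := boolP (i \in P); last first.
  rewrite A0// big1// => s _; case: eqP => [is_|]; last by rewrite mul0r.
  by case/negP: iP; rewrite is_ enum_valP.
rewrite (bigD1 (enum_rank_in iP i))//= enum_rankK_in// eqxx mul1r big1 ?addr0//.
move=> s sP; case: eqP => [is_|]; last by rewrite mul0r.
by case/negP: sP; apply/eqP/enum_val_inj; rewrite enum_rankK_in.
Qed.

(** Subtracting the separable matrix [U *m V], of rank at most [#|S|], leaves a matrix supported on
    the rows in [P]. *)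
Lemma mxrank_separable_off_rows (F : fieldType) p q (S : finType)
    (A : 'M[F]_(p, q)) (P : {set 'I_p}) (u : S -> 'I_p -> F)
    (v : S -> 'I_q -> F) :
  (forall i j, i \notin P -> A i j = \sum_s u s i * v s j) ->
  (\rank A <= #|P| + #|S|)%N.
Proof.
move=> AS.
pose U : 'M[F]_(p, #|S|) := \matrix_(i, s) u (enum_val s) i.
pose V : 'M[F]_(#|S|, q) := \matrix_(s, j) v (enum_val s) j.
have UV i j : (U *m V) i j = \sum_s u s i * v s j.
  rewrite mxE (reindex (@enum_rank S)); last first.
    by exists enum_val => s _; rewrite ?enum_rankK ?enum_valK.
  by apply: eq_bigr => s _; rewrite !mxE enum_rankK.
rewrite -(subrK (U *m V) A); apply: leq_trans (mxrank_add _ _) _.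
apply: leq_add; last exact: mulmx_max_rank.
by apply: mxrank_row_support => i j iP; rewrite !mxE AS// -UV mxE subrr.
Qed.

(** * Taylor expansion of a negative power with relative error *)

(* Taylor coefficients of t |-> (1 - t) `^ (- b) at 0. *)
Fixpoint powRN_coef (R : realType) (b : R) (n : nat) : R :=
  if n is m.+1 then powRN_coef b m * (b + m%:R) / m.+1%:R else 1.

Lemma powRN_coefS (R : realType) (b : R) n :
  n.+1%:R * powRN_coef b n.+1 = powRN_coef b n * (b + n%:R).
Proof. by rewrite mulrC /= divfK. Qed.

Lemma powRN_coef_ge0 (R : realType) (b : R) n : 0 <= b -> 0 <= powRN_coef b n.
Proof.
move=> b0; elim: n => [|n IHn] //=.
by rewrite divr_ge0// mulr_ge0// addr_ge0.
Qed.

(* The quotient of the left by the right side is nonincreasing from n = 5 on. *)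
Lemma powRN_coef_le (R : realType) (b : R) n : 0 <= b <= 3 ->
  n.+1%:R * powRN_coef b n.+1 * 2 ^+ n <= 8 * b * 3 ^+ n.
Proof.
move=> /andP[b0 b3].
pose a m := m.+1%:R * powRN_coef b m.+1.
have a_ge0 m : 0 <= a m by rewrite mulr_ge0// powRN_coef_ge0.
have aS m : m.+1%:R * a m.+1 <= (m + 4)%:R * a m.
  have -> : m.+1%:R * a m.+1 = (b + m.+1%:R) * a m.
    by rewrite /a (powRN_coefS b m.+1); ring.
  rewrite ler_wpM2r// natrD -[m.+1%:R]natr1; lra.
have a0 : a 0 = b by rewrite /a powRN_coefS /= mul1r addr0.
have a1 : a 1 <= 4 * a 0 by have := aS 0; rewrite add0n mul1r.
have a2 : 2 * a 2 <= 5 * a 1 by exact: aS.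
have a3 : 3 * a 3 <= 6 * a 2 by exact: aS.
have a4 : 4 * a 4 <= 7 * a 3 by exact: aS.
have a5 : 5 * a 5 <= 8 * a 4 by exact: aS.
(* The induction step needs 2 * (m + 9) <= 3 * (m + 6), true for every [m]; this is why it starts at
   index 5. The base case holds since the chain above gives [a 5] <= 56 * b, and 56 * 2 ^ 5 <= 8 * 3
   ^ 5. *)
have large m : a (m + 5)%N * 2 ^+ (m + 5) <= 8 * b * 3 ^+ (m + 5).
  elim: m => [|m IHm].
    by rewrite add0n; lra.
  have h := aS (m + 5)%N.
  rewrite addSn !exprS.
  have m0 : 0 < (m + 5).+1%:R :> R by rewrite ltr0n.
  rewrite -(ler_pM2l m0) mulrA.
  set x := a _.+1 in h *; set y := a _ in h IHm; move: h.
  have -> : (m + 5 + 4)%:R = m%:R + 9 :> R by rewrite -addnA natrD.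
  have -> : (m + 5).+1%:R = m%:R + 6 :> R by rewrite -addnS natrD.
  move=> h.
  have p0 : 0 <= 2 ^+ (m + 5) :> R by rewrite exprn_ge0.
  have y0 : 0 <= y by exact: a_ge0.
  have yp0 : 0 <= y * 2 ^+ (m + 5) by rewrite mulr_ge0.
  apply: (@le_trans _ _ ((m%:R + 9) * 2 * (y * 2 ^+ (m + 5)))).
    by have := ler_wpM2r p0 h; lra.
  apply: (@le_trans _ _ ((m%:R + 6) * 3 * (y * 2 ^+ (m + 5)))).
    rewrite ler_wpM2r//; have : 0 <= m%:R :> R by []. lra.
  have : 0 <= (m%:R + 6) * 3 :> R by rewrite mulr_ge0// addr_ge0.
  by move=> h3; have := ler_wpM2l h3 IHm; lra.
have [|n5] := leqP 5 n; first by move/subnK => <-; exact: large.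
move: n n5; do 5 (case; first by move=> _; rewrite -/(a _) ?expr0; lra).
by [].
Qed.

Definition powRN_poly (R : realType) (b : R) (n : nat) : {poly R} :=
  \sum_(k < n) powRN_coef b k *: 'X^k.

(* Hence the derivative of (1 - t) `^ b * (powRN_poly b n.+1).[t] has a single
   term, so that the mean value theorem bounds the relative Taylor remainder. *)
Lemma powRN_poly_deriv (R : realType) (b t : R) n :
  (1 - t) * (powRN_poly b n.+1)^`().[t] - b * (powRN_poly b n.+1).[t]
    = - (n.+1%:R * powRN_coef b n.+1 * t ^+ n).
Proof.
elim: n => [|n IHn].
  rewrite /powRN_poly big_ord1 /= expr0 derivZ derivC !hornerE /=.
  by field.
rewrite /powRN_poly big_ord_recr -/(powRN_poly b n.+1) /=.
rewrite derivD derivZ derivXn !hornerD !hornerZ hornerMn !hornerXn /=.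
rewrite -/(powRN_coef b n.+1) mulrDr mulrDr opprD addrACA IHn.
rewrite (powRN_coefS b n.+1) exprS.
by set c := powRN_coef b n.+1; ring.
Qed.

(** With s = 1 - t, the function [f] is the quotient of the Taylor polynomial by the power that it
    approximates, and [f 1 = 1]. The mean value theorem between 1 and 1 - t bounds the relative
    error by the size of the one-term derivative [df]. *)
Lemma powRN_poly_relative (R : realType) (b t eps : R) (p : nat) :
  2 <= b <= 3 -> `|t| <= 1 / 3 -> 0 < eps -> b * 4 `^ b / eps <= 2 ^+ p ->
  `|(1 - t) `^ b * (powRN_poly b p.+1).[t] - 1| <= eps.
Proof.
move=> /andP[b2 b3] t3 eps0 pP.
pose Q := powRN_poly b p.+1; pose P := Q \Po (1 - 'X).
pose f (s : R) := s `^ b * P.[s].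
pose df (s : R) := s `^ (b - 1) * (p.+1%:R * powRN_coef b p.+1 * (1 - s) ^+ p).
have fd (s : R) : 0 < s -> is_derive s 1 f (df s).
  move=> s0; have h1 := is_derive1_powR b s0.
  have h2 := is_derive_poly P s.
  have h := is_deriveM h1 h2.
  apply: (is_derive_eq h).
  rewrite /P deriv_comp derivB derivC derivX sub0r mulrN1 hornerN !horner_comp hornerD hornerN hornerX hornerC.
  have := powRN_poly_deriv b (1 - s) p; rewrite -/Q subKr => /eqP.
  rewrite subr_eq => /eqP E; rewrite /df.
  rewrite /GRing.scale/=.
  have -> : s `^ b = s `^ (b - 1) * s.
    by rewrite -[X in _ * X]powRr1 ?ltW// -powRD ?subrK// (gt_eqF s0) implybT.
  have -> : p.+1%:R * powRN_coef b p.+1 * (1 - s) ^+ p = b * Q.[1 - s] - s * Q^`().[1 - s].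
    by rewrite E; ring.
  by ring.
have f1 : f 1 = 1.
  rewrite /f powR1 mul1r /P horner_comp !hornerE subrr /Q /powRN_poly.
  rewrite horner_sum big_ord_recl /= expr0 hornerZ hornerC mulr1 big1 ?addr0//.
  by move=> i _; rewrite hornerZ hornerXn expr0n mulr0.
have ft : (1 - t) `^ b * (powRN_poly b p.+1).[t] = f (1 - t).
  by rewrite /f /P horner_comp !hornerE subKr.
have [tl tr] : - (1 / 3) <= t /\ t <= 1 / 3 by move: t3; rewrite ler_norml => /andP.
have [c [c1 c2] ->] : exists2 c : R, 2 / 3 <= c /\ c <= 4 / 3 &
    `|(1 - t) `^ b * (powRN_poly b p.+1).[t] - 1| = `|df c| * `|t|.
  rewrite ft -[X in `|_ - X|]f1.
  have cont (u v : R) : 0 < u -> {within `[u, v], continuous f}.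
    move=> u0; apply: derivable_within_continuous => x.
    rewrite in_itv /= => /andP[ux _].
    by have [] := fd x (lt_le_trans u0 ux).
  have [t0|t0] := leP 0 t.
    have le1 : 1 - t <= 1 by lra.
    have pos : 0 < 1 - t by lra.
    have fd1 (x : R) : x \in `](1 - t), 1[ -> is_derive x 1 f (df x).
      by rewrite in_itv /= => /andP[x1 _]; apply: fd; exact: lt_trans x1.
    have [c] := MVT_segment le1 fd1 (cont _ _ pos).
    rewrite in_itv /= => /andP[c1 c2] e; exists c; first by split; lra.
    by rewrite distrC e normrM; congr (_ * `|_|); lra.
  have le1 : 1 <= 1 - t by lra.
  have fd1 (x : R) : x \in `]1, (1 - t)[ -> is_derive x 1 f (df x).
    by rewrite in_itv /= => /andP[x1 _]; apply: fd; exact: lt_trans x1.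
  have [c] := MVT_segment le1 fd1 (cont _ _ ltr01).
  rewrite in_itv /= => /andP[c1 c2] e; exists c; first by split; lra.
  by rewrite e normrM -(normrN t); congr (_ * `|_|); lra.
have a_ge0 : 0 <= p.+1%:R * powRN_coef b p.+1.
  by rewrite mulr_ge0// powRN_coef_ge0//; lra.
(* Here 4 ^ (b - 1) = 4 ^ b / 4, and 3 ^ (b - 1) >= 3 because b >= 2; hence the 12. *)
have pow : c `^ (b - 1) <= 4 `^ b / 12.
  apply: (@le_trans _ _ ((4 / 3) `^ (b - 1))).
    by apply: ge0_ler_powR; rewrite ?nnegrE//; lra.
  have four : 4 `^ (b - 1) = 4 `^ b / 4 :> R.
    by rewrite powRB ?powRr1//; rewrite pnatr_eq0 implybT.
  have third : 3^-1 `^ (b - 1) = (3 `^ (b - 1))^-1 :> R.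
    by rewrite -powR_inv1// -powRrM mulN1r powRN.
  rewrite powRM// four third.
  have h3 : 3 <= 3 `^ (b - 1) :> R.
    by rewrite -[leLHS]powRr1// ler_powR//; lra.
  have : (3 `^ (b - 1))^-1 <= 3^-1 :> R by rewrite lef_pV2 ?posrE// powR_gt0.
  move=> h; rewrite [leRHS](_ : _ = 4 `^ b / 4 * 3^-1); last by field.
  by rewrite ler_wpM2l// divr_ge0// powR_ge0.
have ab : p.+1%:R * powRN_coef b p.+1 * 2 ^+ p <= 8 * b * 3 ^+ p.
  by apply: powRN_coef_le; apply/andP; split; lra.
have dc : `|1 - c| ^+ p <= (1 / 3) ^+ p.
  by rewrite lerXn2r ?nnegrE// ler_norml; apply/andP; split; lra.
rewrite /df normrM (ger0_norm (powR_ge0 _ _)) normrM (ger0_norm a_ge0) normrX.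
set A := p.+1%:R * _ in a_ge0 ab *.
(* The coefficients grow at most like (3 / 2) ^ p, the powers of 1 - c decay like (1 / 3) ^ p, and 2
   ^ (- p) remains. *)
have {}dc : A * `|1 - c| ^+ p <= 8 * b / 2 ^+ p.
  apply: (@le_trans _ _ (A * (1 / 3) ^+ p)); first by rewrite ler_wpM2l.
  rewrite expr_div_n expr1n ler_pdivlMr ?exprn_gt0// mulrAC mul1r.
  by rewrite ler_pdivrMr ?exprn_gt0.
apply: (@le_trans _ _ (4 `^ b / 12 * (8 * b / 2 ^+ p) * (1 / 3))).
  apply: ler_pM => //.
    by apply: mulr_ge0; [exact: powR_ge0|apply: mulr_ge0 => //; exact: exprn_ge0].
  apply: ler_pM => //; first exact: powR_ge0.
  by apply: mulr_ge0 => //; exact: exprn_ge0.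
move: pP; rewrite ler_pdivrMr// => pP.
(* The three bounds combine to 8 / (12 * 3) = 2 / 9, which is less than 1. *)
rewrite [leLHS](_ : _ = 2 / 9 * (b * 4 `^ b / 2 ^+ p)); last first.
  have : 2 ^+ p != 0 :> R by rewrite expf_neq0.
  by move: (2 ^+ p) => q q0; field.
have : b * 4 `^ b / 2 ^+ p <= eps.
  by rewrite ler_pdivrMr ?exprn_gt0// (mulrC eps).
lra.
Qed.

(** A relative error is invariant under scaling: x - y = (x - c) * (1 - t) with t = (y - c) / (x -
    c) reduces this to the expansion at 0. *)
Lemma powRN_expansion_relative (R : realType) (b x y c eps : R) (p : nat) :
  2 <= b <= 3 -> c < x -> 3 * `|y - c| <= x - c -> 0 < eps ->
  b * 4 `^ b / eps <= 2 ^+ p ->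
  `|(\sum_(k < p.+1) powRN_coef b k * (y - c) ^+ k * (x - c) `^ (- b - k%:R))
      - (x - y) `^ (- b)| <= eps * (x - y) `^ (- b).
Proof.
move=> b23 cx yc eps0 pP; pose t := (y - c) / (x - c).
have xc : 0 < x - c by rewrite subr_gt0.
have t3 : `|t| <= 1 / 3.
  by rewrite /t normrM normfV (gtr0_norm xc) ler_pdivrMr//; lra.
have t1 : 0 < 1 - t by move: t3; rewrite ler_norml => /andP[]; lra.
have xy : x - y = (x - c) * (1 - t) by rewrite /t; field; rewrite gt_eqF.
have xy0 : 0 < (x - y) `^ (- b) by rewrite powR_gt0// xy mulr_gt0.
have rel := powRN_poly_relative b23 t3 eps0 pP.
apply: (@le_trans _ _ `|(x - y) `^ (- b) *
    ((1 - t) `^ b * (powRN_poly b p.+1).[t] - 1)|); last first.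
  by rewrite normrM (gtr0_norm xy0) mulrC ler_wpM2r// ltW.
rewrite le_eqVlt; apply/orP; left; apply/eqP; congr (`|_|).
rewrite mulrBr mulr1; congr (_ - _).
have -> : (x - y) `^ (- b) * ((1 - t) `^ b * (powRN_poly b p.+1).[t]) =
    (x - c) `^ (- b) * (powRN_poly b p.+1).[t].
  rewrite xy powRM ?ltW// mulrA -(mulrA _ _ (_ `^ b)) -powRD ?addNr ?powRr0 ?mulr1//.
  by rewrite (gt_eqF t1) implybT.
rewrite /powRN_poly horner_sum mulr_sumr; apply: eq_bigr => k _.
rewrite hornerZ hornerXn /t expr_div_n powRD; last by rewrite (gt_eqF xc) implybT.
by rewrite (powRN _ k%:R) powR_mulrn ?ltW//; ring.
Qed.

(** * Integrals against bounded factors and propagation of relative errors *)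

Definition bounded_measurable (R : realType) (d : measure_display)
    (T : measurableType d) (D : set T) (h : T -> R) : Prop :=
  measurable_fun D h /\ exists M, forall x, D x -> `|h x| <= M.

Lemma integrableM_bounded_measurable (R : realType) (d : measure_display)
    (T : measurableType d) (mu : {measure set T -> \bar R}) (D : set T)
    (f h : T -> R) : measurable D -> mu.-integrable D (EFin \o f) ->
  bounded_measurable D h -> mu.-integrable D (EFin \o (fun x => f x * h x)).
Proof.
move=> mD If [mh [M hM]].
apply: (eq_integrable mD _ _ _ (integrableMl mD If mh _)).
  by move=> x _; rewrite /= EFinM.
exists M; split; first exact: num_real.
by move=> N MN x Dx; apply: le_trans (ltW MN); exact: hM.
Qed.

Lemma Rintegral_sum (R : realType) (d : measure_display)
    (T : measurableType d) (mu : {measure set T -> \bar R}) (D : set T)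
    (S : finType) (F : S -> T -> R) : measurable D ->
  (forall s, mu.-integrable D (EFin \o F s)) ->
  (\int[mu]_(x in D) \sum_s F s x = \sum_s \int[mu]_(x in D) F s x)%R.
Proof.
move=> mD IF; elim: (index_enum S) => [|s r IHr].
  rewrite big_nil; under eq_Rintegral do rewrite big_nil.
  by rewrite Rintegral_cst// mul0r.
rewrite big_cons -IHr -RintegralD//.
  by apply: eq_Rintegral => x _; rewrite big_cons.
apply: (eq_integrable mD _ _ _ 
  (@integrable_sum _ _ _ mu D mD _ r xpredT (fun s x => (F s x)%:E)
    (fun s _ => IF s))).
by move=> x _; rewrite /= sumEFin.
Qed.

Lemma Rintegral_support (R : realType) (d : measure_display)
    (T : measurableType d) (mu : {measure set T -> \bar R}) (A D : set T)
    (f : T -> R) : A `<=` D -> (forall x, D x -> ~ A x -> f x = 0) ->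
  (\int[mu]_(x in D) f x = \int[mu]_(x in A) f x)%R.
Proof.
move=> AD f0; rewrite Rintegral_mkcond [RHS]Rintegral_mkcond.
congr Rintegral; apply/funext => x; rewrite !patchE.
case: ifPn => [xD|xD].
  case: ifPn => // xA; apply: f0; first exact: set_mem.
  by move=> Ax; rewrite (mem_set Ax) in xA.
case: ifPn => // /set_mem/AD Dx.
by rewrite (mem_set Dx) in xD.
Qed.

(** A nonnegative weight carries a pointwise relative error over to the integrals with the same
    constant, so the step can be iterated, first in [y] and then in [x]. *)
Lemma Rintegral_relative_error (R : realType) (d : measure_display)
    (T : measurableType d) (mu : {measure set T -> \bar R}) (D : set T)
    (f w v : T -> R) (e : R) : measurable D ->
  mu.-integrable D (EFin \o (fun x => f x * w x)) ->
  mu.-integrable D (EFin \o (fun x => f x * v x)) ->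
  (forall x, D x -> 0 <= f x) ->
  (forall x, D x -> `|v x - w x| <= e * w x) ->
  `| (\int[mu]_(x in D) (f x * v x) - \int[mu]_(x in D) (f x * w x))%R |
    <= e * (\int[mu]_(x in D) (f x * w x))%R.
Proof.
move=> mD Iw Iv f0 vw; rewrite -RintegralB// -RintegralZl//.
have Ivw : mu.-integrable D (EFin \o (fun x => f x * v x - f x * w x)).
  apply: (eq_integrable mD _ _ _ (integrableB mD Iv Iw)).
  by move=> x _; rewrite /= EFinB.
apply: (le_trans (le_normr_Rintegral mD Ivw)).
apply: le_Rintegral => //.
- apply: (eq_integrable mD _ _ _ (integrable_abse Ivw)).
  by [].
- apply: (eq_integrable mD _ _ _ (integrableZl mD e Iw)).
  by move=> x _; rewrite /= EFinM.
move=> x Dx; rewrite -mulrBr normrM ger0_norm ?f0// mulrCA.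
by rewrite ler_wpM2l ?f0 ?vw.
Qed.

(** The power is monotone, in a direction that depends on the sign of [g]; the sum of both endpoint
    values covers the two cases at once. *)
Lemma powR_le_endpoints (R : realType) (g lo hi t : R) :
  0 < lo -> lo <= t <= hi -> t `^ g <= lo `^ g + hi `^ g.
Proof.
move=> lo0 /andP[lot thi]; have t0 := lt_le_trans lo0 lot.
have [g0|g0] := leP 0 g.
  apply: (@le_trans _ _ (hi `^ g)); last by rewrite lerDr powR_ge0.
  by apply: ge0_ler_powR => //; rewrite nnegrE ltW// (lt_le_trans t0).
apply: (@le_trans _ _ (lo `^ g)); last by rewrite lerDl powR_ge0.
rewrite -(opprK g) powRN [leRHS]powRN lef_pV2 ?posrE ?powR_gt0//.
by apply: ge0_ler_powR => //; rewrite ?nnegrE ?oppr_ge0// ltW.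
Qed.

(** * Dyadic separable approximation of the kernel *)

(* The l-th interval is x0 - 2 ^+ l.+1 * delta < y <= x0 - 2 ^+ l * delta; its
   centre c satisfies 3 * `|y - c| <= x - c for x >= x0. *)
Definition dyadic_center (R : realType) (x0 delta : R) (l : nat) : R :=
  x0 - 3 / 2 * (2 ^+ l * delta).

(** In a term [s], the component [s.1] numbers the dyadic interval and [s.2] is the Taylor degree.
    The dependence on [x] is collected here; [dyadic_col] holds that on [y], including the cutoff to
    the interval. *)
Definition dyadic_row (R : realType) (b x0 delta : R) m n
    (s : 'I_m * 'I_n) (x : R) : R :=
  powRN_coef b s.2 * (x - dyadic_center x0 delta s.1) `^ (- b - s.2%:R).

Definition dyadic_col (R : realType) (x0 delta : R) m n
    (s : 'I_m * 'I_n) (y : R) : R :=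
  \1_(`]x0 - 2 ^+ s.1.+1 * delta, x0 - 2 ^+ s.1 * delta]%classic) y *
  (y - dyadic_center x0 delta s.1) ^+ s.2.

Lemma bounded_measurable_dyadic_col (R : realType) (x0 delta : R) m n
    (s : 'I_m * 'I_n) (D : set R) :
  bounded_measurable D (dyadic_col x0 delta s).
Proof.
split.
  apply: measurable_funM; first by apply: measurable_indic; exact: measurable_itv.
  by apply: measurable_funX; exact: measurable_funB.
exists ((2 ^+ s.1 * `|delta|) ^+ s.2) => y _; rewrite /dyadic_col /dyadic_center.
have p2 : 0 < 2 ^+ s.1 :> R by rewrite exprn_gt0.
pose q : R := 2 ^+ s.1; rewrite -/q in p2 *.
rewrite indicE; have [|] := boolP (y \in _); last first.
  by move=> _; rewrite mul0r normr0 exprn_ge0// mulr_ge0// ltW.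
rewrite mem_setE in_itv /= => /andP[y1 y2].
rewrite mul1r normrX lerXn2r ?nnegrE ?mulr_ge0 ?(ltW p2)//.
have := ler_norm delta; rewrite exprS -mulrA -/q in y1.
move=> /(ler_wpM2l (ltW p2)) dn.
rewrite ler_norml; apply/andP; split; lra.
Qed.

Lemma dyadic_scale (R : realType) (delta r : R) m : delta <= r < 2 ^+ m * delta ->
  exists l : 'I_m, 2 ^+ l * delta <= r < 2 ^+ l.+1 * delta.
Proof.
move=> /andP[dr]; elim: m => [|m IHm] rm.
  by move: rm; rewrite mul1r ltNge dr.
have [/IHm[l hl]|le] := ltP r (2 ^+ m * delta).
  by exists (widen_ord (leqnSn m) l).
by exists ord_max; rewrite le.
Qed.

(** The dyadic intervals are disjoint, so only the one containing [y] contributes. There |y - c| is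
    at most half of 2 ^ l * delta, while x - c is at least 3 / 2 of it. *)
Lemma dyadic_kernel_relative (R : realType) (b x0 delta eps x y : R) m p :
  2 <= b <= 3 -> 0 < delta -> 0 < eps -> b * 4 `^ b / eps <= 2 ^+ p ->
  x0 <= x -> delta <= x0 - y < 2 ^+ m * delta ->
  `| (\sum_(s : 'I_m * 'I_p.+1)
       dyadic_row b x0 delta s x * dyadic_col x0 delta s y)
     - (x - y) `^ (- b)| <= eps * (x - y) `^ (- b).
Proof.
move=> b23 d0 e0 pP x0x yr; have [l /andP[l1 l2]] := dyadic_scale yr.
have mono (i j : nat) : (i <= j)%N -> 2 ^+ i * delta <= 2 ^+ j * delta.
  by move=> ij; rewrite ler_wpM2r ?(ltW d0)// ler_weXn2l// ler1n.
set c := dyadic_center x0 delta l.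
have q0 : 0 < 2 ^+ l * delta by rewrite mulr_gt0// exprn_gt0.
rewrite exprS -mulrA in l2.
have cE : c = x0 - 3 / 2 * (2 ^+ l * delta) by [].
have -> : \sum_(s : 'I_m * 'I_p.+1)
       dyadic_row b x0 delta s x * dyadic_col x0 delta s y =
    \sum_(k < p.+1) powRN_coef b k * (y - c) ^+ k * (x - c) `^ (- b - k%:R).
  rewrite -(pair_bigA _ (fun i k => dyadic_row b x0 delta (i, k) x *
    dyadic_col x0 delta (i, k) y))/= (bigD1 l)//=.
  rewrite [X in _ + X]big1 ?addr0.
    apply: eq_bigr => k _; rewrite /dyadic_row /dyadic_col /= -/c indicE.
    rewrite mem_set; first by rewrite /= mul1r; ring.
    rewrite /= in_itv /= exprS -mulrA; apply/andP; split; lra.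
  move=> i il; rewrite big1// => k _; rewrite /dyadic_col /= indicE.
  rewrite memNset ?mul0r ?mulr0//= in_itv /= => /andP[y1 y2].
  have [li|li|/val_inj li] := ltngtP (val i) (val l); last by rewrite li eqxx in il.
    by have := mono _ _ li; lra.
  by have := mono _ _ li; rewrite exprS -mulrA; lra.
apply: powRN_expansion_relative => //; first by lra.
by rewrite -lter_pdivlMl// ler_norml; apply/andP; split; lra.
Qed.

(** * Differentiating the Riemann-Liouville integral off the support *)

Lemma is_derive_translate (R : realType) (f : R -> R) (x y df : R) :
  is_derive (x - y) 1 f df -> is_derive x 1 (fun t => f (t - y)) df.
Proof.
have E : (fun h : R => h^-1 *: (((fun t => f (t - y)) \o shift x) (h *: (1 : R))
      - f (x - y))) =
    (fun h : R => h^-1 *: ((f \o shift (x - y)) (h *: (1 : R)) - f (x - y))).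
  by apply/funext => h /=; rewrite addrA.
move=> [Df fd]; apply: DeriveDef; first by rewrite /derivable E.
by rewrite -fd /derive E.
Qed.

Lemma bounded_measurable_powR (R : realType) (D : set R) (h : R -> R)
    (g lo hi : R) : measurable D -> measurable_fun D h -> 0 < lo ->
  (forall y, D y -> lo <= h y <= hi) ->
  bounded_measurable D (fun y => h y `^ g).
Proof.
move=> mD mh lo0 hD; split; first exact: (measurableT_comp (measurable_powR g) mh).
exists (lo `^ g + hi `^ g) => y Dy; rewrite ger0_norm ?powR_ge0//.
by apply: powR_le_endpoints => //; exact: hD.
Qed.

(** The domain ends at a fixed [z] and not at [x]; for [x] beyond [z] the kernel has no singularity
    on it and no boundary term appears. *)
Definition potential (R : realType) (a z g : R) (f : R -> R) (x : R) : R :=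
  (\int[@lebesgue_measure R]_(y in `[a, z]) (f y * (x - y) `^ g))%R.

Lemma integrable_potential (R : realType) (a z g x : R) (f : R -> R) :
  z < x -> (@lebesgue_measure R).-integrable `[a, z] (EFin \o f) ->
  (@lebesgue_measure R).-integrable `[a, z]
    (EFin \o (fun y => f y * (x - y) `^ g)).
Proof.
move=> zx If; apply: integrableM_bounded_measurable => //.
apply: (@bounded_measurable_powR _ _ _ _ (x - z) (x - a)) => //.
- exact: measurable_funB.
- by rewrite subr_gt0.
- by move=> y; rewrite /= in_itv /= => /andP[ay yz]; apply/andP; split; lra.
Qed.

Lemma is_derive_potential (R : realType) (a z g x : R) (f : R -> R) :
  z < x -> (@lebesgue_measure R).-integrable `[a, z] (EFin \o f) ->
  is_derive x 1 (potential a z g f) (g * potential a z (g - 1) f x).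
Proof.
(* The midpoint [u] keeps t - y above u - z > 0 for all t in the neighbourhood, so one integrable
   majorant [G] serves for all these t. *)
move=> zx If; pose u := (x + z) / 2; pose v := x + 1.
have uz : 0 < u - z by rewrite /u; lra.
have ux : u < x by rewrite /u; lra.
have Ix : `]u, v[%classic x by rewrite /= in_itv /= /v ux /=; lra.
pose h (t y : R) := f y * (t - y) `^ g.
have dh (t y : R) : y < t -> is_derive t 1 (h ^~ y) (f y * (g * (t - y) `^ (g - 1))).
  move=> yt; have ty : 0 < t - y by rewrite subr_gt0.
  exact: is_deriveZ (is_derive_translate (is_derive1_powR g ty)).
have lt_uv (t y : R) : `]u, v[%classic t -> `[a, z]%classic y -> y < t.
  by rewrite /= !in_itv /= => /andP[ut _] /andP[_ yz]; lra.
pose M := (u - z) `^ (g - 1) + (v - a) `^ (g - 1).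
pose G y := `|f y| * (`|g| * M).
have M0 : 0 <= M by rewrite addr_ge0 ?powR_ge0.
have G0 y : 0 <= G y by rewrite /G !mulr_ge0.
have IG : (@lebesgue_measure R).-integrable `[a, z] (EFin \o G).
  have Ia := integrable_abse If.
  apply: (eq_integrable _ _ _ _ (integrableZl _ (`|g| * M) Ia)) => //.
  by move=> y _; exact: (congr1 EFin (mulrC (`|g| * M) `|f y|)).
have Ih t : `]u, v[%classic t ->
    (@lebesgue_measure R).-integrable `[a, z] (EFin \o h t).
  rewrite /= in_itv /= => /andP[ut _].
  by apply: integrable_potential => //; lra.
have Dh t y : `]u, v[%classic t -> `[a, z]%classic y -> derivable (h ^~ y) t 1.
  by move=> ut yz; have [] := dh _ _ (lt_uv _ _ ut yz).
have dhE t y : y < t -> partial1of2 h t y = f y * (g * (t - y) `^ (g - 1)).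
  by move=> yt; rewrite partial1of2E; have [_ ->] := dh _ _ yt.
have Gub t y : `]u, v[%classic t -> `[a, z]%classic y ->
    `|partial1of2 h t y| <= G y.
  move=> ut yz; rewrite dhE ?lt_uv// !normrM ler_wpM2l// ler_wpM2l//.
  rewrite ger0_norm ?powR_ge0//; apply: powR_le_endpoints => //.
  move: ut yz; rewrite /= !in_itv /= => /andP[ut tv] /andP[ay yz].
  by apply/andP; split; lra.
have mB := measurable_itv `[a, z].
have D := @derivable_under_integral R _ _ (@lebesgue_measure R) h _
  mB _ _ _ Ix Ih Dh _ G0 IG Gub.
have E := @differentiation_under_integral R _ _ (@lebesgue_measure R) h _
  mB _ _ _ Ix Ih Dh _ G0 IG Gub.
apply: DeriveDef; first exact: D.
rewrite -derive1E [LHS]E /potential.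
rewrite -RintegralZl//; last exact: integrable_potential.
apply: eq_Rintegral => y; rewrite inE /= in_itv /= => /andP[_ yz].
by rewrite dhE; [rewrite mulrCA|exact: le_lt_trans zx].
Qed.

Lemma RL_integralE (R : realType) (alpha xL z x : R) (f : R -> R) :
  supp f `<=` `[xL, z] -> z <= x ->
  RL_integral alpha xL f x = potential xL z (- alpha + 1) f x.
Proof.
move=> fz zx; apply: Rintegral_support.
  by move=> y; rewrite /= !in_itv /= => /andP[-> /le_trans->].
move=> y _ nz; have [->|f0] := eqVneq (f y) 0; first by rewrite mul0r.
by case: nz; apply: fz; exact: subset_closure.
Qed.

(** The integral agrees with a potential at all points beyond [z], hence near [x], and a derivative
    is local. *)
Lemma derive1_RL_integral (R : realType) (alpha xL z x : R) (f : R -> R) :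
  supp f `<=` `[xL, z] ->
  (@lebesgue_measure R).-integrable `[xL, z] (EFin \o f) -> z < x ->
  derive1 (RL_integral alpha xL f) x =
    (- alpha + 1) * potential xL z (- alpha) f x.
Proof.
move=> fz If zx; have [_] := is_derive_potential (- alpha + 1) zx If.
rewrite addrK => <-; rewrite derive1E; apply: near_eq_derive.
near=> t; apply: RL_integralE => //; apply: ltW.
by near: t; exact: lt_nbhsr.
Unshelve. all: by end_near. Qed.

Lemma derive2_RL_integral (R : realType) (alpha xL z x : R) (f : R -> R) :
  supp f `<=` `[xL, z] ->
  (@lebesgue_measure R).-integrable `[xL, z] (EFin \o f) -> z < x ->
  derive1n 2 (RL_integral alpha xL f) x =
    alpha * (alpha - 1) * potential xL z (- (alpha + 1)) f x.
Proof.
move=> fz If zx.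
have := is_deriveZ (- alpha + 1) (is_derive_potential (- alpha) zx If).
move=> [_]; rewrite [- alpha - 1](_ : _ = - (alpha + 1)); last by rewrite opprD.
set d := 'D_1 _ x => dE.
transitivity d; last by rewrite dE /GRing.scale/=; ring.
rewrite derive1nS derive1n1 derive1E; apply: near_eq_derive.
near=> t; rewrite (derive1_RL_integral _ fz If)//.
by near: t; exact: lt_nbhsr.
Unshelve. all: by end_near. Qed.

(** The left-handed integral at a point sees [f] only to the left of it, so it vanishes identically
    near [x]. *)
Lemma derive2_RL_integral0 (R : realType) (alpha xL z x : R) (f : R -> R) :
  (forall y, y < z -> f y = 0) -> x < z ->
  derive1n 2 (RL_integral alpha xL f) x = 0.
Proof.
move=> f0 xz.
have I0 t : t < z -> RL_integral alpha xL f t = 0.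
  move=> tz; rewrite /RL_integral; under eq_Rintegral.
    move=> y; rewrite inE /= in_itv /= => /andP[_ yt].
    rewrite f0 ?mul0r; last exact: le_lt_trans tz.
    over.
  by rewrite Rintegral_cst ?mul0r.
have D0 t : t < z -> derive1 (RL_integral alpha xL f) t = 0.
  move=> tz; rewrite derive1E -[RHS](derive_cst (0 : R) t 1).
  by apply: near_eq_derive; near=> s; apply: I0; near: s; exact: lt_nbhsl.
rewrite derive1nS derive1n1 derive1E -[RHS](derive_cst (0 : R) x 1).
by apply: near_eq_derive; near=> s; apply: D0; near: s; exact: lt_nbhsl.
Unshelve. all: by end_near. Qed.

Lemma bounded_measurable_potential (R : realType) (a z g u v : R)
    (f : R -> R) : z < u -> (forall y, 0 <= f y) ->
  (@lebesgue_measure R).-integrable `[a, z] (EFin \o f) ->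
  bounded_measurable `[u, v] (potential a z g f).
Proof.
move=> zu f0 If.
have cont : {within `[u, v], continuous (potential a z g f)}.
  apply: derivable_within_continuous => x; rewrite in_itv /= => /andP[ux _].
  by have [] := is_derive_potential g (lt_le_trans zu ux) If.
split.
  by apply: subspace_continuous_measurable_fun => //; exact: measurable_itv.
have [uv|vu] := leP u v; last first.
  exists 0 => x; rewrite /= in_itv /= => /andP[ux xv]; lra.
(* The potential of a nonnegative function is nonnegative, so a maximum alone bounds its absolute
   value. *)
have [c _ cmax] := EVT_max uv cont.
exists (potential a z g f c) => x xuv; rewrite ger0_norm ?cmax//.
by apply: Rintegral_ge0 => y _; rewrite mulr_ge0// powR_ge0.
Qed.

(** * The bilinear form for functions with separated supports *)

Lemma integrable_supp (R : realType) (xL xR u v : R) (f : R -> R) :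
  xL <= u -> v <= xR ->
  (@lebesgue_measure R).-integrable `[xL, xR] (EFin \o f) ->
  (@lebesgue_measure R).-integrable `[u, v] (EFin \o f).
Proof.
move=> xu vx; apply: integrableS; [exact: measurable_itv..|].
by move=> y; rewrite /= !in_itv /= => /andP[uy yv]; apply/andP; split; lra.
Qed.

Lemma supp_notin (R : realType) (f : R -> R) (D : set R) (x : R) :
  supp f `<=` D -> ~ D x -> f x = 0.
Proof.
move=> fD nD; have [//|f0] := eqVneq (f x) 0.
by case: nD; apply: fD; exact: subset_closure.
Qed.

(** Up to [v] the derivative vanishes because [f] starts only at [u]; beyond [v] the factor [h]
    vanishes. *)
Lemma RL_form_upper (R : realType) (alpha xL xR u v : R) (h f : R -> R) :
  v < u -> supp h `<=` `[xL, v] -> supp f `<=` `[u, xR] ->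
  (\int[@lebesgue_measure R]_(x in `[xL, xR])
    (h x * derive1n 2 (RL_integral alpha xL f) x))%R = 0.
Proof.
move=> vu hv fu.
transitivity (\int[@lebesgue_measure R]_(x in `[xL, xR]) (0 : R))%R; last first.
  by rewrite Rintegral_cst ?mul0r.
apply: eq_Rintegral => x _; have [xv|vx] := leP x v.
  rewrite (@derive2_RL_integral0 _ _ _ u) ?mulr0//; last exact: le_lt_trans vu.
  move=> y yu; apply: (supp_notin fu); rewrite /= in_itv /= => /andP[uy _].
  by rewrite leNgt yu in uy.
rewrite (supp_notin hv) ?mul0r//= in_itv /= => /andP[_ xv].
by rewrite leNgt vx in xv.
Qed.

Lemma RL_form_lower (R : realType) (alpha xL xR u v : R) (h f : R -> R) :
  xL <= u -> v <= xR -> v < u -> supp h `<=` `[u, xR] -> supp f `<=` `[xL, v] ->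
  (forall y, 0 <= f y) ->
  (@lebesgue_measure R).-integrable `[xL, xR] (EFin \o h) ->
  (@lebesgue_measure R).-integrable `[xL, xR] (EFin \o f) ->
  (\int[@lebesgue_measure R]_(x in `[xL, xR])
    (h x * derive1n 2 (RL_integral alpha xL f) x))%R =
  alpha * (alpha - 1) * (\int[@lebesgue_measure R]_(x in `[u, xR])
    (h x * potential xL v (- (alpha + 1)) f x))%R.
Proof.
move=> xu vx vu hu fv f0 Ih If.
have Ifv := integrable_supp (lexx xL) vx If.
have Ihu := integrable_supp xu (lexx xR) Ih.
rewrite (@Rintegral_support R _ _ (@lebesgue_measure R) `[u, xR]).
- rewrite -RintegralZl//; last first.
    apply: integrableM_bounded_measurable => //.
    exact: bounded_measurable_potential.
  apply: eq_Rintegral => x /set_mem xD.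
  have ux : u <= x by move: xD; rewrite /= in_itv /= => /andP[].
  rewrite (derive2_RL_integral _ fv Ifv (lt_le_trans vu ux)).
  exact: mulrCA.
- by move=> y; rewrite /= !in_itv /= => /andP[/(le_trans xu)-> ->].
- by move=> x _ nux; rewrite (supp_notin hu)// mul0r.
Qed.

(** The kernel estimate, with exponent [alpha + 1] between 2 and 3, is integrated against [f] and
    then against [h]. In each term one factor depends only on [h] and the other only on [f], which
    bounds the rank once [h] and [f] run through rows and columns. *)
Lemma RL_form_separable (R : realType) (alpha xL xR x0 delta eps S : R)
    (m p : nat) (h f : R -> R) :
  1 < alpha < 2 -> 0 < delta -> 0 < eps -> xL <= x0 -> x0 + delta <= xR ->
  (alpha + 1) * 4 `^ (alpha + 1) / eps <= 2 ^+ p ->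
  xR - xL <= 2 ^+ m * delta ->
  supp h `<=` `[x0 + delta, xR] -> supp f `<=` `[xL, x0 - delta] ->
  (forall y, 0 <= h y) -> (forall y, 0 <= f y) ->
  (@lebesgue_measure R).-integrable `[xL, xR] (EFin \o h) ->
  (@lebesgue_measure R).-integrable `[xL, xR] (EFin \o f) ->
  S = (\int[@lebesgue_measure R]_(x in `[xL, xR])
    (h x * derive1n 2 (RL_integral alpha xL f) x))%R ->
  `| (\sum_(s : 'I_m * 'I_p.+1)
      (alpha * (alpha - 1) * (\int[@lebesgue_measure R]_(x in `[x0 + delta, xR])
        (h x * dyadic_row (alpha + 1) x0 delta s x))) *
      (\int[@lebesgue_measure R]_(y in `[xL, x0 - delta])
        (f y * dyadic_col x0 delta s y)))%R - S | <= eps * S.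
Proof.
move=> /andP[al1 al2] d0 e0 xx0 xdx pP mP hs fs h0 f0 Ih If SE.
have xu : xL <= x0 + delta by lra.
have vx : x0 - delta <= xR by lra.
have vu : x0 - delta < x0 + delta by lra.
have Ifv := integrable_supp (lexx xL) vx If.
have Ihu := integrable_supp xu (lexx xR) Ih.
pose C := alpha * (alpha - 1).
have C0 : 0 <= C by rewrite mulr_ge0; lra.
pose K := potential xL (x0 - delta) (- (alpha + 1)) f.
pose kappa (s : 'I_m * 'I_p.+1) := (\int[@lebesgue_measure R]_(y in
  `[xL, x0 - delta]) (f y * dyadic_col x0 delta s y))%R.
(* [Kt] is [K] with the approximate kernel, the integration in [y] being already carried out in
   [kappa]. *)
pose Kt x := \sum_(s : 'I_m * 'I_p.+1)
  dyadic_row (alpha + 1) x0 delta s x * kappa s.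
have -> : S = C * (\int[@lebesgue_measure R]_(x in `[x0 + delta, xR]) (h x * K x))%R.
  by rewrite SE; exact: RL_form_lower.
have Brow (s : 'I_m * 'I_p.+1) : bounded_measurable `[x0 + delta, xR]
    (dyadic_row (alpha + 1) x0 delta s).
  have cx : dyadic_center x0 delta s.1 < x0.
    by rewrite /dyadic_center ltrBlDr ltrDl !mulr_gt0// exprn_gt0.
  have [||||mr [M hM]] := @bounded_measurable_powR _ `[x0 + delta, xR]
    (fun x => x - dyadic_center x0 delta s.1) (- (alpha + 1) - s.2%:R)
    (x0 - dyadic_center x0 delta s.1) (xR - dyadic_center x0 delta s.1).
  - exact: measurable_itv.
  - exact: measurable_funB.
  - by rewrite subr_gt0.
  - by move=> y; rewrite /= in_itv /= => /andP[y1 y2]; apply/andP; split; lra.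
  split; first exact: measurable_funM.
  exists (`|powRN_coef (alpha + 1) s.2| * M) => y Dy.
  by rewrite normrM ler_wpM2l// hM.
have Irow (s : 'I_m * 'I_p.+1) : (@lebesgue_measure R).-integrable
    `[x0 + delta, xR] (EFin \o (fun x => h x * dyadic_row (alpha + 1) x0 delta s x)).
  by apply: integrableM_bounded_measurable => //; exact: Brow.
have Icol (s : 'I_m * 'I_p.+1) : (@lebesgue_measure R).-integrable
    `[xL, x0 - delta] (EFin \o (fun y => f y * dyadic_col x0 delta s y)).
  apply: integrableM_bounded_measurable => //.
  exact: bounded_measurable_dyadic_col.
have IKt : (@lebesgue_measure R).-integrable
    `[x0 + delta, xR] (EFin \o (fun x => h x * Kt x)).
  apply: integrableM_bounded_measurable => //; split.
    by apply: measurable_sum => s; apply: measurable_funM => //; case: (Brow s).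
  have [M hM] := choice (fun s => (Brow s).2).
  exists (\sum_s M s * `|kappa s|) => x xD; apply: le_trans (ler_norm_sum _ _ _) _.
  by apply: ler_sum => s _; rewrite normrM ler_wpM2r// hM.
have IK : (@lebesgue_measure R).-integrable
    `[x0 + delta, xR] (EFin \o (fun x => h x * K x)).
  apply: integrableM_bounded_measurable => //.
  exact: bounded_measurable_potential.
have -> : (\sum_(s : 'I_m * 'I_p.+1)
      (alpha * (alpha - 1) * (\int[@lebesgue_measure R]_(x in `[x0 + delta, xR])
        (h x * dyadic_row (alpha + 1) x0 delta s x))) *
      (\int[@lebesgue_measure R]_(y in `[xL, x0 - delta])
        (f y * dyadic_col x0 delta s y)))%R =
    C * (\int[@lebesgue_measure R]_(x in `[x0 + delta, xR]) (h x * Kt x))%R.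
  transitivity (C * (\int[@lebesgue_measure R]_(x in `[x0 + delta, xR])
      \sum_s (h x * dyadic_row (alpha + 1) x0 delta s x * kappa s))%R).
    rewrite Rintegral_sum//.
      rewrite mulr_sumr; apply: eq_bigr => s _.
      by rewrite RintegralZr// mulrA.
    move=> s; apply: (eq_integrable _ _ _ _ (integrableZr _ (kappa s) (Irow s))) => //.
  congr (C * _); apply: eq_Rintegral => x _.
  by rewrite /Kt mulr_sumr; apply: eq_bigr => s _; rewrite mulrA.
rewrite -mulrBr normrM (ger0_norm C0) mulrCA ler_wpM2l//.
(* This is the integration in [x]; it leaves the comparison of [Kt] with [K] at a fixed [x], which
   is again an integral, in [y]. *)
apply: Rintegral_relative_error => // x; rewrite /= in_itv /= => /andP[ux xxR].
have -> : Kt x = (\int[@lebesgue_measure R]_(y in `[xL, x0 - delta])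
    (f y * \sum_(s : 'I_m * 'I_p.+1)
      dyadic_row (alpha + 1) x0 delta s x * dyadic_col x0 delta s y))%R.
  transitivity (\int[@lebesgue_measure R]_(y in `[xL, x0 - delta])
      \sum_(s : 'I_m * 'I_p.+1) (dyadic_row (alpha + 1) x0 delta s x * (f y * dyadic_col x0 delta s y)))%R.
    rewrite Rintegral_sum//; first by apply: eq_bigr => s _; rewrite RintegralZl.
    move=> s; apply: (eq_integrable _ _ _ _ (integrableZl _
      (dyadic_row (alpha + 1) x0 delta s x) (Icol s))) => //.
  apply: eq_Rintegral => y _.
  by rewrite mulr_sumr; apply: eq_bigr => s _; rewrite mulrCA.
apply: Rintegral_relative_error => //.
- by apply: integrable_potential => //; lra.
- apply: integrableM_bounded_measurable => //; split.
    apply: measurable_sum => s; apply: measurable_funM => //.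
    by case: (bounded_measurable_dyadic_col x0 delta s `[xL, x0 - delta]).
  have [M hM] := choice (fun s : 'I_m * 'I_p.+1 =>
    (bounded_measurable_dyadic_col x0 delta s `[xL, x0 - delta]).2).
  exists (\sum_s `|dyadic_row (alpha + 1) x0 delta s x| * M s) => y yD.
  apply: le_trans (ler_norm_sum _ _ _) _.
  by apply: ler_sum => s _; rewrite normrM ler_wpM2l// hM.
move=> y; rewrite /= in_itv /= => /andP[y1 y2].
apply: dyadic_kernel_relative => //.
- by apply/andP; split; lra.
- lra.
(* The strict bound comes from x0 + delta <= xR: x0 - y <= x0 - xL < xR - xL <= 2 ^ m * delta. *)
- by apply/andP; split; lra.
Qed.

(** * Integer logarithms, index counts and auxiliary bounds *)

Lemma ceil_log2 (R : realType) (x : R) : 1 <= x ->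
  exists2 n : nat, Num.ceil (log2 x) = n%:Z & x <= 2 ^+ n.
Proof.
move=> x1; have x0 : 0 < x by apply: lt_le_trans x1.
have ln2 : 0 < ln 2 :> R by rewrite ln_gt0// ltr1n.
have l0 : 0 <= log2 x by apply: divr_ge0; [exact: ln_ge0|exact: ltW].
have c0 : 0 <= Num.ceil (log2 x) by rewrite ceil_ge0 (lt_le_trans _ l0) ?ltrN10.
case E : (Num.ceil (log2 x)) c0 => [n|//] _; exists n => //.
have : log2 x <= n%:R.
  by rewrite -[n%:R]/(n%:~R) -E; exact: ceil_ge.
by rewrite /log2 ler_pdivrMr// mulr_natl -lnXn// ler_ln ?posrE ?exprn_gt0.
Qed.

Lemma ceil_log2_gt0 (R : realType) (x : R) : 1 < x -> 0 < Num.ceil (log2 x).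
Proof.
move=> x1; rewrite ceil_gt0; apply: divr_gt0; apply: ln_gt0 => //.
by rewrite ltr1n.
Qed.

Lemma card_ord_window n (I : {set 'I_n}) (P : {set 'I_#|I|}) (a k : nat) :
  (forall r, r \in P -> a <= (@enum_val _ (mem I) r : nat) < a + k)%N ->
  (#|P| <= k)%N.
Proof.
move=> h; rewrite cardE -(size_iota a k).
rewrite -(size_map (fun r => val (@enum_val _ (mem I) r))).
apply: uniq_leq_size.
  rewrite map_inj_uniq ?enum_uniq// => r s /val_inj; exact: enum_val_inj.
move=> _ /mapP[r rP ->]; rewrite mem_iota; apply: h.
by rewrite mem_enum in rP.
Qed.

(** A function supported in a point or in the empty set has integral 0, not 1. Through this,
    normalization turns support conditions into inequalities between endpoints. *)
Lemma supp_proper (R : realType) (xL xR u v : R) (f : R -> R) :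
  xL <= u -> v <= xR -> supp f `<=` `[u, v] ->
  (\int[@lebesgue_measure R]_(x in `[xL, xR]) f x)%R = 1 -> u < v.
Proof.
move=> xu vx fuv; rewrite ltNge; apply: contra_eqN => vu.
rewrite (@Rintegral_support R _ _ (@lebesgue_measure R) `[u, v]).
- move: vu; rewrite le_eqVlt => /orP[/eqP->|vu].
    by rewrite set_itv1 Rintegral_set1 eq_sym oner_neq0.
  by rewrite set_itv_ge ?bnd_simp -?ltNge// Rintegral_set0 eq_sym oner_neq0.
- by move=> y; rewrite /= !in_itv /= => /andP[uy yv]; apply/andP; split; lra.
- by move=> x _ nx; exact: supp_notin fuv nx.
Qed.

Lemma Gamma_ge0 (R : realType) (s : R) : 0 <= Gamma s.
Proof.
by apply: Rintegral_ge0 => t _; rewrite mulr_ge0 ?powR_ge0 ?expR_ge0.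
Qed.

Definition real_stiffness (R : realType) (alpha xL xR : R) N
    (phi : 'I_N -> R -> R) : 'M[R]_N :=
  \matrix_(i, j) ((Gamma (2 - alpha))^-1 *
    (\int[@lebesgue_measure R]_(x in `[xL, xR])
      (phi i x * derive1n 2 (RL_integral alpha xL (phi j)) x))%R).

Lemma stiffnessE (R : realType) (alpha xL xR : R) N (phi : 'I_N -> R -> R) :
  stiffness alpha xL xR phi =
  map_mx (real_complex R) (real_stiffness alpha xL xR phi).
Proof. by apply/matrixP => i j; rewrite !mxE. Qed.

Lemma min_perturbed_rank_le_min (R : realType) p q (Y : 'M[R[i]]_(p, q)) (t : R)
    (r : nat) : 0 <= t -> (\rank Y <= r)%N -> (min_perturbed_rank Y t <= r)%N.
Proof.
move=> t0 Yr; apply: (@min_perturbed_rank_le _ _ _ _ 0).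
  by rewrite spectral_norm0.
by rewrite addr0.
Qed.

Lemma spectral_norm_submatrix (R : realType) n (X : 'M[R[i]]_n)
    (I J : {set 'I_n}) : spectral_norm (submatrix X I J) <= spectral_norm X.
Proof. by apply: spectral_norm_mxsub; exact: enum_val_inj. Qed.

(** Minus the block itself is an admissible perturbation. This settles eps >= 1, where the second
    logarithm might be negative. *)
Lemma min_perturbed_rank_large (R : realType) n (X : 'M[R[i]]_n)
    (I J : {set 'I_n}) (e : R) : 1 <= e ->
  min_perturbed_rank (submatrix X I J) (e * spectral_norm X) = 0%N.
Proof.
move=> e1; apply/eqP; rewrite -leqn0.
apply: (@min_perturbed_rank_le _ _ _ _ (- submatrix X I J)).
  rewrite spectral_normN (le_trans (spectral_norm_submatrix X I J))//.
  by rewrite ler_peMl ?spectral_norm_ge0.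
by rewrite subrr mxrank0.
Qed.

Lemma strictly_lowerP n (I J : {set 'I_n}) (i j : 'I_n) :
  strictly_lower I J -> i \in I -> j \in J -> (j < i)%N.
Proof. by move=> /forall_inP IJ iI jJ; have /forall_inP := IJ _ iI; apply. Qed.

Lemma strictly_upperP n (I J : {set 'I_n}) (i j : 'I_n) :
  strictly_upper I J -> i \in I -> j \in J -> (i < j)%N.
Proof. by move=> /forall_inP IJ iI jJ; have /forall_inP := IJ _ iI; apply. Qed.

Lemma exists_min_ord n (I : {set 'I_n}) : (0 < #|I|)%N ->
  exists2 i1 : 'I_n, i1 \in I & forall i, i \in I -> (i1 <= i)%N.
Proof.
move=> /card_gt0P[i0 i0I].
by case: (@arg_minnP _ i0 (mem I) (@nat_of_ord n) i0I) => i1 i1I h; exists i1.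
Qed.


Lemma card_ord_tail n (I : {set 'I_n}) (a k : nat) :
  (forall i : 'I_n, i \in I -> (a <= i)%N) -> (n <= a + k)%N -> (#|I| <= k)%N.
Proof.
move=> aI nk; rewrite -[#|I|]card_ord -cardsT.
apply: (@card_ord_window _ I _ a) => r _.
by rewrite aI ?enum_valP//= (leq_trans (ltn_ord _) nk).
Qed.

(** The overlap condition at [j] and [j + k] puts the support of [phi i] into [xL, x0 - delta] with
    x0 <= xR, and that interval must have positive length. *)
Lemma overlapping_length (R : realType) (xL xR : R) N (phi : 'I_N -> R -> R)
    (delta : R) (k : nat) (i j : 'I_N) :
  0 < delta -> overlapping xL xR phi delta k ->
  (forall i, (\int[@lebesgue_measure R]_(x in `[xL, xR]) phi i x)%R = 1) ->
  (i < j)%N -> (j + k < N)%N -> delta < xR - xL.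
Proof.
move=> d0 hov phi1 ij jk.
have [x0 [x0D left _]] := hov j (Ordinal jk) (leqnn _).
move: x0D; rewrite in_itv /= => /andP[xx0 x0x].
have vx : x0 - delta <= xR by lra.
have := supp_proper (lexx xL) vx (left i ij) (phi1 i); lra.
Qed.

(** * Ranks of the off-diagonal blocks and the final count *)

Lemma lower_block_rank (R : realType) (alpha : R) (xL xR : R) N
    (phi : 'I_N -> R -> R) (delta : R) (k : nat) (eps : R) (m p : nat)
    (I J : {set 'I_N}) :
  1 < alpha < 2 -> fe_basis xL xR phi -> 0 < delta ->
  overlapping xL xR phi delta k -> (forall i x, 0 <= phi i x) ->
  (forall i, (\int[@lebesgue_measure R]_(x in `[xL, xR]) phi i x)%R = 1) ->
  0 < eps -> (alpha + 1) * 4 `^ (alpha + 1) / eps <= 2 ^+ p ->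
  xR - xL <= 2 ^+ m * delta -> strictly_lower I J ->
  (min_perturbed_rank (submatrix (stiffness alpha xL xR phi) I J)
    (eps * spectral_norm (stiffness alpha xL xR phi)) <= k.+1 + m * p.+1)%N.
Proof.
move=> al hb d0 hov phi0 phi1 e0 pP mP IJ.
set S := stiffness alpha xL xR phi.
have t0 : 0 <= eps * spectral_norm S by rewrite mulr_ge0 ?spectral_norm_ge0// ltW.
have [I0|/exists_min_ord[i1 i1I i1min]] := posnP #|I|.
  apply: min_perturbed_rank_le_min => //.
  by rewrite (leq_trans (rank_leq_row _))// I0.
(* If [i1 + k] is no index, the whole block has at most [k] rows. *)
have [Nk|kN] := leqP N (i1 + k).
  apply: min_perturbed_rank_le_min => //.
  rewrite (leq_trans (rank_leq_row _))// (leq_trans (card_ord_tail i1min Nk))//.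
  by rewrite addSn -addnS leq_addr.
have [x0 [x0D left right]] := hov i1 (Ordinal kN) (leqnn _).
move: x0D; rewrite in_itv /= => /andP[xx0 x0x].
pose u (s : 'I_m * 'I_p.+1) i := (Gamma (2 - alpha))^-1 * (alpha * (alpha - 1) *
  (\int[@lebesgue_measure R]_(x in `[x0 + delta, xR])
    (phi i x * dyadic_row (alpha + 1) x0 delta s x))%R).
pose v (s : 'I_m * 'I_p.+1) j := (\int[@lebesgue_measure R]_(y in
  `[xL, x0 - delta]) (phi j y * dyadic_col x0 delta s y))%R.
pose s := real_stiffness alpha xL xR phi.
have approx (i j : 'I_N) : (i1 + k < i)%N -> (j < i1)%N ->
    `|\sum_s u s i * v s j - s i j| <= eps * s i j.
  move=> ik ji.
  have si := right i ik; have sj := left j ji.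
  have xdx : x0 + delta <= xR by apply/ltW/(supp_proper _ _ si (phi1 i)) => //; lra.
  have := RL_form_separable al d0 e0 xx0 xdx pP mP si sj (phi0 i) (phi0 j)
    (fe_integrable hb i) (fe_integrable hb j) (erefl _).
  (* The Gamma factor multiplies entry and error alike; being nonnegative, it keeps the relative
     bound. *)
  have G0 : 0 <= (Gamma (2 - alpha))^-1 by rewrite invr_ge0 Gamma_ge0.
  move=> /(ler_wpM2l G0); rewrite -[X in X * `|_|](ger0_norm G0) -normrM.
  rewrite mulrBr mulr_sumr mulrCA /s mxE.
  by under eq_bigr do rewrite mulrA.
pose ri (r : 'I_#|I|) := @enum_val _ (mem I) r.
pose cj (c : 'I_#|J|) := @enum_val _ (mem J) c.
pose P : {set 'I_#|I|} := [set r | (ri r <= i1 + k)%N]%SET.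
(* The rows of P are left unperturbed: their number is at most k.+1. *)
pose D : 'M[R]_(#|I|, #|J|) := \matrix_(r, c)
  if r \in P then 0 else \sum_s u s (ri r) * v s (cj c) - s (ri r) (cj c).
have good r c : r \notin P -> (i1 + k < ri r)%N /\ (cj c < i1)%N.
  by rewrite inE -ltnNge => ->; split=> //; apply: (strictly_lowerP IJ) => //; exact: enum_valP.
have SE : submatrix S I J = map_mx (real_complex R) (mxsub ri cj s).
  by apply/matrixP => r c; rewrite /S stiffnessE !mxE.
apply: (@min_perturbed_rank_le _ _ _ _ (map_mx (real_complex R) D)).
  (* The error is controlled by the norm of the block, which is at most that of the whole matrix. *)
  apply: (@le_trans _ _ (eps * spectral_norm (submatrix S I J))); last first.
    by rewrite ler_wpM2l ?(ltW e0) ?spectral_norm_submatrix.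
  rewrite SE; apply: (@spectral_norm_dominated _ _ _ (fun r => r \notin P)).
  - exact: ltW.
  - move=> r c rP; have [? ?] := good r c rP.
    by rewrite [D r c]mxE [mxsub _ _ _ r c]mxE (negPf rP) approx.
  - by move=> r c; rewrite negbK => rP; rewrite mxE rP.
apply: (@leq_trans (#|P| + #|{: 'I_m * 'I_p.+1}|)).
  apply: (@mxrank_separable_off_rows _ _ _ _ _ _
    (fun s r => (u s (ri r))%:C%C) (fun s c => (v s (cj c))%:C%C)) => r c rP.
  rewrite SE 2!mxE [map_mx _ D r c]mxE -rmorphD [D r c]mxE (negPf rP).
  rewrite [mxsub _ _ _ r c]mxE addrC subrK rmorph_sum /=.
  by apply: eq_bigr => w _; rewrite rmorphM.
rewrite card_prod !card_ord leq_add2r.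
(* The rows of [P] have indices from [i1] to [i1 + k] inclusive, hence the bound [k.+1]. *)
apply: (@card_ord_window _ I _ i1) => r; rewrite inE => rP.
by rewrite i1min ?enum_valP//= addnS ltnS.
Qed.

(** Let [j1] be the first column; all rows lie before it. For a column beyond [j1 + k] the trial
    function lives to the right of every test function of the block, and the left-handed derivative
    vanishes there. Transposition turns such columns into zero rows. *)
Lemma upper_block_rank (R : realType) (alpha : R) (xL xR : R) N
    (phi : 'I_N -> R -> R) (delta : R) (k : nat) (I J : {set 'I_N}) :
  0 < delta -> overlapping xL xR phi delta k -> strictly_upper I J ->
  (\rank (submatrix (stiffness alpha xL xR phi) I J) <= k.+1)%N.
Proof.
move=> d0 hov IJ; set S := stiffness alpha xL xR phi.
rewrite -mxrank_tr.
have [J0|/exists_min_ord[j1 j1J j1min]] := posnP #|J|.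
  by rewrite (leq_trans (rank_leq_row _))// J0.
pose P : {set 'I_#|J|} := [set c | (@enum_val _ (mem J) c < j1 + k.+1)%N]%SET.
apply: (@leq_trans #|P|); last first.
  apply: (@card_ord_window _ J _ j1) => c; rewrite inE => cP.
  by rewrite j1min ?enum_valP.
apply: mxrank_row_support => c r; rewrite inE -leqNgt addnS => kc.
have kN : (j1 + k < N)%N by apply: ltn_trans kc (ltn_ord _).
have [x0 [_ left right]] := hov j1 (Ordinal kN) (leqnn _).
rewrite !mxE (@RL_form_upper _ _ _ _ (x0 + delta) (x0 - delta)) ?mulr0//.
- by lra.
- by apply: left; apply: (strictly_upperP IJ) => //; exact: enum_valP.
- exact: right.
Qed.

Theorem theorem3p20 (R : realType) (alpha : R) (halpha : 1 < alpha < 2)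
    (xL xR : R) (hLR : xL < xR) (N : nat) (phi : 'I_N -> R -> R)
    (hbasis : fe_basis xL xR phi)
    (delta : R) (hdelta : 0 < delta) (k : nat)
    (hoverlap : overlapping xL xR phi delta k)
    (hnonneg : forall i x, 0 <= phi i x)
    (hnormalized : forall i,
      (\int[@lebesgue_measure R]_(x in `[xL, xR]) phi i x)%R = 1)
    (eps : R) (heps : 0 < eps) :
  ((qsrank eps (stiffness alpha xL xR phi))%:Z
     <= k%:Z + k_eps alpha xL xR delta eps)%R.
Proof.
have K0 : 0 <= k_eps alpha xL xR delta eps by rewrite /k_eps le_max lexx.
case E : (k_eps alpha xL xR delta eps) K0 => [K|//] _.
rewrite -PoszD lez_nat; apply/bigmax_leqP => -[I J] /= IJ.
set S := stiffness alpha xL xR phi.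
have [e1|e1] := leP 1 eps; first by rewrite min_perturbed_rank_large.
have t0 : 0 <= eps * spectral_norm S by rewrite mulr_ge0 ?spectral_norm_ge0 ?(ltW heps).
have [I0|/exists_min_ord[i0 i0I i0min]] := posnP #|I|.
  apply: min_perturbed_rank_le_min => //.
  by rewrite (leq_trans (rank_leq_row _))// I0.
have [J0|/exists_min_ord[j0 j0J j0min]] := posnP #|J|.
  apply: min_perturbed_rank_le_min => //.
  by rewrite (leq_trans (rank_leq_col _))// J0.
(* Since eps < 1, the argument of the logarithm is at least 1 and its ceiling is a natural number
   [p]; the expansion has [p.+1] terms. *)
have b1 : 1 <= (alpha + 1) * 4 `^ (alpha + 1) / eps.
  case/andP: halpha => al1 al2.
  rewrite ler_pdivlMr// mul1r (le_trans (ltW e1))// mulr_ege1//; first lra.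
  by rewrite -[leLHS](powRr0 4) ler_powR//; lra.
have [p pE pP] := ceil_log2 b1.
(* When the interval is no longer than [delta], the overlap condition can only hold if every column
   or row index after the first lies among the last [k], so the block has at most [k] rows or at
   most [k] columns. *)
have [small|large] := leP (xR - xL) delta.
  have tail (i j : 'I_N) : (i < j)%N -> (N <= j + k)%N.
    move=> ij; rewrite leqNgt; apply/negP => jk.
    by move: small; rewrite leNgt (overlapping_length hdelta hoverlap hnormalized ij jk).
  apply: min_perturbed_rank_le_min => //; rewrite (leq_trans _ (leq_addr _ _))//.
  case/orP: IJ => IJ.
    rewrite (leq_trans (rank_leq_row _))// (card_ord_tail i0min)//.
    exact: tail (strictly_lowerP IJ i0I j0J).
  rewrite (leq_trans (rank_leq_col _))// (card_ord_tail j0min)//.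
  exact: tail (strictly_upperP IJ i0I j0J).
have r1 : 1 < (xR - xL) / delta by rewrite ltr_pdivlMr// mul1r.
have [m mE mP] := ceil_log2 (ltW r1).
have m0 : (0 < m)%N by rewrite -ltz_nat -mE ceil_log2_gt0.
rewrite ler_pdivrMr// in mP.
have -> : K = (2 * m * (1 + p))%N.
  by move: E; rewrite /k_eps mE pE max_r// => -[<-].
have bound : (k.+1 + m * p.+1 <= k + 2 * m * (1 + p))%N.
  by rewrite -mulnA mul2n -addnn add1n addnA leq_add2r -addn1 leq_add2l muln_gt0 m0.
case/orP: IJ => IJ; last first.
  apply: min_perturbed_rank_le_min => //; apply: leq_trans bound.
  by rewrite (leq_trans (upper_block_rank _ hdelta hoverlap IJ))// leq_addr.
apply: leq_trans bound.
exact: (lower_block_rank halpha hbasis hdelta hoverlap hnonneg hnormalized heps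
  pP mP IJ).
Qed.
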